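(* Let $f:F\to(-\infty,+\infty]$ and $g:E\to(-\infty,+\infty]$ be two convex, proper, lower semi-continuous functions and let $K:E\to F$ be a linear operator. Suppose that the saddle-point problem $$\min_{x\in E}\max_{y\in F}\ h(x,y),\qquad h(x,y)=\langle Kx,y\rangle+g(x)-f^*(y),$$ admits a solution $(\hat x,\hat y)$. Denote $L=\|K\|=\sqrt{\|K^*K\|}$ and take $\sigma,\tau>0$ such that $\tau\sigma L^2<1$. Choose $(x_0,y_0)\in E\times F$, set $\bar x_0=x_0$, and define the sequences $(x_n)$, $(y_n)$, $(\bar x_n)$ by $$y_{n+1}=\operatorname{prox}_{\sigma f^*}(y_n+\sigma K\bar x_n),\qquad x_{n+1}=\operatorname{prox}_{\tau g}(x_n-\tau K^*y_{n+1}),\qquad \bar x_{n+1}=2x_{n+1}-x_n.$$ Then: 1. For all $n\in\mathbb{N}$, $$\frac{\|y_n-\hat y\|^2}{2\sigma}+\frac{\|x_n-\hat x\|^2}{2\tau}\le(1-\tau\sigma L^2)^{-1}\left(\frac{\|y_0-\hat y\|^2}{2\sigma}+\frac{\|x_0-\hat x\|^2}{2\tau}\right).$$ 2. For $N\ge1$ set $x^N=\frac1N\sum_{n=1}^N x_n$ and $y^N=\frac1N\sum_{n=1}^N y_n$. Then for each bounded set $B_1\times B_2\subset E\times F$, the partial primal-dual gap satisfies $$\mathcal{G}_{B_1\times B_2}(x^N,y^N)\le\frac{D(B_1,B_2)}{N},\qquad D(B_1,B_2)=\sup_{(x,y)\in B_1\times B_2}\frac{\|x-x_0\|^2}{2\tau}+\frac{\|y-y_0\|^2}{2\sigma}.$$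 3. The sequence $(x_n,y_n)_{n\in\mathbb{N}}$ converges to a solution $(x^*,y^* )$ of the saddle-point problem.
   Context: $E$ and $F$ are finite-dimensional Euclidean spaces. $K^*:F\to E$ is the adjoint of $K$. The convex conjugate is $f^*(u)=\sup_{z\in F}\langle z,u\rangle-f(z)$. For a proper convex lower semi-continuous function $\phi$ and $\gamma>0$, $\operatorname{prox}_{\gamma\phi}(x)=\arg\min_z\gamma\phi(z)+\frac12\|x-z\|^2$. A solution of the saddle-point problem is a saddle point of $h$: $(\hat x,\hat y)$ with $h(\hat x,y)\le h(\hat x,\hat y)\le h(x,\hat y)$ for all $x\in E,y\in F$. The partial primal-dual gap on (non-empty) bounded sets is $$\mathcal{G}_{B_1\times B_2}(x,y)=\max_{y'\in B_2}\bigl(\langle y',Kx\rangle-f^*(y')+g(x)\bigr)-\min_{x'\in B_1}\bigl(\langle y,Kx'\rangle+g(x')-f^*(y)\bigr),$$ where max and min are understood as supremum and infimum. *)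

(* Defs.v *)
From HB Require Import structures.
From mathcomp Require Import all_boot all_order all_algebra.
From mathcomp Require Import all_classical all_reals all_analysis.

Set Implicit Arguments.
Unset Strict Implicit.
Unset Printing Implicit Defensive.

Import Order.TTheory GRing.Theory Num.Theory.
Import numFieldNormedType.Exports.

Local Open Scope classical_set_scope.
Local Open Scope ring_scope.

(* [Vector] supplies the finite dimension. Positive definiteness of the inner
   product follows from [inner_sqr_norm] and the norm axioms. *)
HB.mixin Record NormedVector_isEuclidean (R : realType) E
    of NormedModule R E & Vector R E := {
  inner : E -> E -> R ;
  innerC : forall x y, inner x y = inner y x ;
  inner_linearl : forall a x y z,
    inner (a *: x + y) z = a * inner x z + inner y z ;
  inner_sqr_norm : forall x, inner x x = `|x| ^+ 2
}.

#[short(type="euclideanType")]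
HB.structure Definition Euclidean (R : realType) :=
  {E of NormedModule R E & Vector R E & NormedVector_isEuclidean R E}.

Section linear_operators.
Context {R : realType} {E F : euclideanType R}.

Definition is_adjoint (K : E -> F) (Kadj : F -> E) : Prop :=
  forall x y, inner (K x) y = inner x (Kadj y).

(* The set is nonempty and, [E] being finite-dimensional, bounded above
   whenever [K] is linear, so that the real-valued [sup] is meaningful. *)
Definition opnorm (K : E -> F) : R :=
  sup [set `|K x| | x in [set x : E | `|x| <= 1]].

End linear_operators.

Section convex_analysis.
Context {R : realType} {E : euclideanType R}.
Implicit Types (phi : E -> \bar R).
Local Open Scope ereal_scope.

Definition proper_function phi : Prop :=
  (forall x, -oo < phi x) /\ (exists x, phi x < +oo).

(* At t = 0 and t = 1 this uses 0 * +oo = 0. *)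
Definition econvex phi : Prop :=
  forall x y (t : R), (0 <= t <= 1)%R ->
    phi (t *: x + (1 - t) *: y)%R <= t%:E * phi x + (1 - t)%:E * phi y.

Definition conjugate phi (u : E) : \bar R :=
  ereal_sup [set (inner z u)%:E - phi z | z in [set: E]].

Definition prox_argmin (gamma : R) phi (x : E) : set E :=
  [set z | forall w, gamma%:E * phi z + (`|x - z| ^+ 2 / 2)%:E
                  <= gamma%:E * phi w + (`|x - w| ^+ 2 / 2)%:E].

(* 0 if the set of minimizers is empty. *)
Definition prox (gamma : R) phi (x : E) : E :=
  xget 0%R (prox_argmin gamma phi x).

End convex_analysis.

Section saddle_point.
Context {R : realType} {E F : euclideanType R}.
Variables (K : E -> F) (f : F -> \bar R) (g : E -> \bar R).
Local Open Scope ereal_scope.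

(* In [\bar R], +oo - +oo = -oo. For f and g convex, proper and lower
   semicontinuous, this convention does not affect which pairs are saddle
   points: at a saddle point both g x and conjugate f y are finite. *)
Definition lagrangian (x : E) (y : F) : \bar R :=
  (inner (K x) y)%:E + g x - conjugate f y.

Definition saddle_point (xh : E) (yh : F) : Prop :=
  forall x y, lagrangian xh y <= lagrangian xh yh /\
              lagrangian xh yh <= lagrangian x yh.

Definition partial_gap (B1 : set E) (B2 : set F) (x : E) (y : F) : \bar R :=
  ereal_sup [set (inner y' (K x))%:E - conjugate f y' + g x | y' in B2] -
  ereal_inf [set (inner y (K x'))%:E + g x' - conjugate f y | x' in B1].

End saddle_point.

Section gap_constant.
Context {R : realType} {E F : euclideanType R}.

Definition gap_constant (tau sigma : R) (x0 : E) (y0 : F)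
    (B1 : set E) (B2 : set F) : \bar R :=
  ereal_sup [set (`|p.1 - x0| ^+ 2 / (2 * tau)
                  + `|p.2 - y0| ^+ 2 / (2 * sigma))%:E | p in B1 `*` B2].

End gap_constant.

Definition average {R : realType} {E : euclideanType R} (x : nat -> E)
    (N : nat) : E :=
  N%:R^-1 *: \sum_(1 <= n < N.+1) x n.

(* Main.v *)
(* Write x_{-1} = x_0, s = sqrt (tau sigma) L, and, for a pair (w, v) at which g
   and f^* are finite,
     dist2_n = |y_n - v|^2 / (2 sigma) + |x_n - w|^2 / (2 tau),
     a_n = |x_n - x_{n-1}|^2 / (2 tau),  b_n = |y_{n+1} - y_n|^2 / (2 sigma),
     c_n = <K (x_n - x_{n-1}), y_n - v>,  gap_n = h(x_n, v) - h(w, y_n).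
   Adding the variational inequalities of the two proximal steps gives
     gap_{n+1} + dist2_{n+1} + c_{n+1} + a_{n+1} + (1 - s) b_n
       <= dist2_n + c_n + s a_n =: V_n.
   As s < 1 and dist2_n + c_n + a_n >= (1 - s^2) dist2_n, summation bounds the
   sum of the gaps, and dist2_N, in terms of dist2_0. The first claim follows
   because gap_n >= 0 when (w, v) is a saddle point, the second one by Jensen's
   inequality. Moreover V_n is then nonnegative and nonincreasing, so
   consecutive iterates get arbitrarily close; by lower semicontinuity every
   cluster point of the bounded sequence (x_n, y_n) is a saddle point, and for
   (w, v) equal to such a cluster point V_n tends to 0 along a subsequence,
   hence along the whole sequence, which forces dist2_n to tend to 0. *)
Require Import Defs.
From HB Require Import structures.
From mathcomp Require Import all_boot all_order all_algebra.
From mathcomp Require Import all_classical all_reals all_analysis.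
From mathcomp Require Import ring lra.

Import Order.TTheory GRing.Theory Num.Theory.
Import numFieldNormedType.Exports.

Local Open Scope classical_set_scope.
Local Open Scope ring_scope.

(** * Inner product calculus *)

Section inner_product.
Context {R : realType} {E : euclideanType R}.
Implicit Types x y z : E.

Lemma innerDl x y z : inner (x + y) z = inner x z + inner y z.
Proof. by rewrite -{1}[x]scale1r inner_linearl mul1r. Qed.

Lemma inner0l z : inner 0 z = 0.
Proof. by apply: (addrI (inner 0 z)); rewrite -innerDl !addr0. Qed.

Lemma innerZl a x z : inner (a *: x) z = a * inner x z.
Proof. by rewrite -[a *: x]addr0 inner_linearl inner0l addr0. Qed.

Lemma innerNl x z : inner (- x) z = - inner x z.
Proof. by rewrite -scaleN1r innerZl mulN1r. Qed.

Lemma innerBl x y z : inner (x - y) z = inner x z - inner y z.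
Proof. by rewrite innerDl innerNl. Qed.

Lemma innerDr x y z : inner z (x + y) = inner z x + inner z y.
Proof. by rewrite !(innerC z) innerDl. Qed.

Lemma innerZr a x z : inner z (a *: x) = a * inner z x.
Proof. by rewrite !(innerC z) innerZl. Qed.

Lemma innerNr x z : inner z (- x) = - inner z x.
Proof. by rewrite !(innerC z) innerNl. Qed.

Lemma innerBr x y z : inner z (x - y) = inner z x - inner z y.
Proof. by rewrite !(innerC z) innerBl. Qed.

Lemma inner_sumr I r (P : pred I) (F : I -> E) z :
  inner z (\sum_(i <- r | P i) F i) = \sum_(i <- r | P i) inner z (F i).
Proof.
by apply: (big_morph (inner z)) => [x y|]; rewrite ?innerDr// innerC inner0l.
Qed.

Lemma sqr_normD x y : `|x + y| ^+ 2 = `|x| ^+ 2 + 2 * inner x y + `|y| ^+ 2.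
Proof.
by rewrite -!inner_sqr_norm innerDl !innerDr (innerC y x); ring.
Qed.

Lemma sqr_normB x y : `|x - y| ^+ 2 = `|x| ^+ 2 - 2 * inner x y + `|y| ^+ 2.
Proof. by rewrite sqr_normD innerNr normrN; ring. Qed.

(** Turns the inner products of the proximal inequalities into differences of squared distances,
    which telescope. *)
Lemma three_point x y z t : 0 < t ->
  inner (x - y) (z - y) / t = `|y - x| ^+ 2 / (2 * t) + `|y - z| ^+ 2 / (2 * t)
    - `|x - z| ^+ 2 / (2 * t).
Proof.
move=> t0; have -> : x - z = (x - y) - (z - y) by rewrite opprB addrA subrK.
by rewrite (sqr_normB (x - y)) !(distrC y); field; rewrite gt_eqF.
Qed.

(** Cauchy-Schwarz is derived from the triangle inequality: the norm comes with its axioms, and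
    squaring [|x + y| <= |x| + |y|] leaves exactly this. *)
Lemma inner_le_norm x y : inner x y <= `|x| * `|y|.
Proof.
have h : `|x + y| ^+ 2 <= (`|x| + `|y|) ^+ 2.
  by rewrite lerXn2r ?nnegrE ?addr_ge0 ?ler_normD.
by move: h; rewrite sqr_normD; nra.
Qed.

Lemma norm_inner_le x y : `|inner x y| <= `|x| * `|y|.
Proof.
by rewrite ler_norml inner_le_norm lerNl -innerNl -(normrN x) inner_le_norm.
Qed.

(** Polarization reduces the claim to continuity of the norm. *)
Lemma cvg_inner (u v : nat -> E) (a b : E) :
  u n @[n --> \oo] --> a -> v n @[n --> \oo] --> b ->
  inner (u n) (v n) @[n --> \oo] --> inner a b.
Proof.
have pol (p q : E) : inner p q = 4^-1 * (`|p + q| * `|p + q| - `|p - q| * `|p - q|).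
  by rewrite -!expr2 sqr_normD sqr_normB; field.
move=> ua vb; rewrite pol; under eq_fun do rewrite pol.
apply: cvgM; first exact: cvg_cst.
apply: cvgB; apply: cvgM; apply: cvg_norm;
  by [apply: cvgD | apply: cvgB].
Qed.

End inner_product.

(* Pairing with the vectors of a basis maps E linearly to R^n; it is bounded by
   Cauchy-Schwarz and its inverse is given by the Gram matrix, so continuity
   and compactness can be transported from R^n. *)
Section finite_dimension.
Import VectorInternalTheory.
Context {R : realType} {E : euclideanType R}.

Lemma linear_rV_continuous (V : normedModType R) n
  (h : {linear 'rV[R]_n -> V}) : continuous h.
Proof.
apply: bounded_linear_continuous; apply/linear_boundedP.
exists (\sum_(j < n) `|h (delta_mx 0 j)|); split; first exact: num_real.
move=> r /ltW Mr v; apply: le_trans (ler_wpM2r _ Mr) => //.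
rewrite {1}[v]row_sum_delta linear_sum mulr_suml.
apply: le_trans (ler_norm_sum _ _ _) _; apply: ler_sum => j _.
rewrite linearZ /= normrZ mulrC ler_wpM2l//.
by rewrite [leRHS]/Num.norm /= mx_normrE; apply/bigmax_geP; right => /=; exists (0, j).
Qed.

Let n := dim E.
Let b (i : 'I_n) : E := @r2v R E (delta_mx 0 i).
Let Phi (w : E) : 'rV[R]_n := \row_i inner w (b i).

Let Phi_linear : linear Phi.
Proof. by move=> a u v; apply/rowP => i; rewrite !mxE inner_linearl. Qed.

HB.instance Definition _ := GRing.isLinear.Build R E 'rV[R]_n *:%R Phi Phi_linear.

Let Gram : 'M[R]_n := \matrix_(i, j) inner (b i) (b j).

Let r2v_sum (u : 'rV[R]_n) : @r2v R E u = \sum_i u 0 i *: b i.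
Proof. by rewrite {1}[u]row_sum_delta linear_sum; under eq_bigr do rewrite linearZ. Qed.

Let Phi_r2v u : Phi (@r2v R E u) = u *m Gram.
Proof.
apply/rowP => j; rewrite !mxE innerC r2v_sum inner_sumr.
by apply: eq_bigr => i _; rewrite innerZr mxE innerC.
Qed.

(** A row vector in the kernel of [Gram] represents an element of [E] orthogonal to every basis
    vector, hence to itself. *)
Let Gram_unit : Gram \in unitmx.
Proof.
rewrite -row_free_unit; apply: inj_row_free => v vG0.
apply: (can_inj r2vK); rewrite linear0; apply/eqP; rewrite -normr_eq0.
rewrite -sqrf_eq0 -inner_sqr_norm {2}r2v_sum.
rewrite inner_sumr big1 // => i _; rewrite innerZr.
have /rowP/(_ i) := Phi_r2v v; rewrite vG0 !mxE => ->.
by rewrite mulr0.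
Qed.

Let Psi (u : 'rV[R]_n) : E := @r2v R E (u *m invmx Gram).

Let Psi_linear : linear Psi.
Proof. by move=> a u v; rewrite /Psi mulmxDl -scalemxAl linearP. Qed.

HB.instance Definition _ := GRing.isLinear.Build R 'rV[R]_n E *:%R Psi Psi_linear.

Let PhiK w : Psi (Phi w) = w.
Proof. by rewrite /Psi -{1}[w]v2rK Phi_r2v mulmxK// v2rK. Qed.

Let Phi_bounded : exists M, forall w, `|Phi w| <= M * `|w|.
Proof.
exists (\sum_i `|b i|) => w.
rewrite [leLHS]/Num.norm /= mx_normrE; apply/bigmax_leP; split=> [|[i j] _] /=.
  by rewrite mulr_ge0// sumr_ge0.
rewrite mxE; apply: le_trans (norm_inner_le _ _) _; rewrite mulrC ler_wpM2r//.
by rewrite (bigD1 j)//= lerDl sumr_ge0.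
Qed.

Let Phi_continuous : continuous Phi.
Proof.
apply: bounded_linear_continuous; apply/linear_boundedP.
have [M hM] := Phi_bounded; exists M; split; first exact: num_real.
by move=> r /ltW Mr v; apply: le_trans (ler_wpM2r _ Mr).
Qed.

Lemma linear_euclidean_continuous {V : normedModType R} (h : {linear E -> V}) :
  continuous h.
Proof.
have -> : h = (h \o Psi) \o Phi :> (E -> V).
  by apply/funext => w /=; rewrite PhiK.
move=> w; apply: continuous_comp; first exact: Phi_continuous.
exact: linear_rV_continuous.
Qed.

(** [s] is not claimed to be increasing: [k <= s k] already makes limits of a whole sequence pass to
    its composition with [s]. *)
Lemma bounded_seq_cvg_subseq {u : nat -> E} {M : R} :
  (forall k, `|u k| <= M) ->
  exists (s : nat -> nat) (a : E), (forall k, (k <= s k)%N) /\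
     u (s k) @[k --> \oo] --> a.
Proof.
move=> uM; have [C hC] := Phi_bounded.
have C0 k : `|Phi (u k)| <= `|C| * M.
  apply: le_trans (hC _) _; apply: le_trans (ler_wpM2r _ (ler_norm C)) _ => //.
  by rewrite ler_wpM2l.
pose A := [set v : 'rV[R]_n | `|v| <= `|C| * M].
have cA : compact A.
  apply: bounded_closed_compact.
    exists (`|C| * M); split; first exact: num_real.
    by move=> r /ltW Mr v vA; exact: le_trans vA Mr.
  by apply: (closed_comp (f := fun v : 'rV[R]_n => `|v|)
                         (D := [set r | r <= `|C| * M]));
    [move=> ? _; exact: norm_continuous | exact: closed_le].
have [] := cA ((Phi \o u) @ \oo).
  by apply: filterS (fun k (_ : True) => C0 k) _; exact: filterT.
move=> c [_ clc].
have ex k : exists m, (k <= m)%N /\ `|c - Phi (u m)| < k.+1%:R^-1.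
  have tailk : ((Phi \o u) @ \oo) [set Phi (u m) | m in [set m | (k <= m)%N]].
    by exists k => // m /= km; exists m.
  have ballc : nbhs c [set v | `|c - v| < k.+1%:R^-1].
    have : id v @[v --> c] --> c by exact: cvg_id.
    by move=> /cvgr_dist_lt; apply; rewrite invr_gt0.
  by have [v [[m /= km <-] /= cm]] := clc _ _ tailk ballc; exists m.
have [s hs] := choice ex; exists s, (Psi c); split=> [k|]; first by have [] := hs k.
have sc : Phi (u (s k)) @[k --> \oo] --> c.
  apply/cvgrPdist_lt => e e0.
  near=> k; have [_ /lt_trans] := hs k; apply.
  by near: k; exact: near_infty_natSinv_lt (PosNum e0).
have : Psi (Phi (u (s k))) @[k --> \oo] --> Psi c.
  by apply: continuous_cvg => //; exact: linear_rV_continuous.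
by under eq_fun do rewrite PhiK.
Unshelve. all: by end_near. Qed.

End finite_dimension.

(** * Operator norm *)

Section operator_norm.
Context {R : realType} {E F : euclideanType R} (K : {linear E -> F}).

Lemma has_sup_opnorm : has_sup [set `|K x| | x in [set x : E | `|x| <= 1]].
Proof.
split; first by exists `|K 0|, 0; rewrite //= normr0.
have /linear_boundedP [M [_ /(_ (M + 1)) hM]] :=
  continuous_linear_bounded 0 (linear_euclidean_continuous K 0).
exists `|M + 1| => _ [x /= x1 <-].
apply: le_trans (hM _ x) _; first by rewrite ltrDl.
by apply: le_trans (ler_wpM2r _ (ler_norm _)) _ => //; rewrite ler_piMr.
Qed.

Lemma opnorm_ge0 : 0 <= opnorm K.
Proof.
apply: le_trans (ub_le_sup has_sup_opnorm.2 _); first exact: (normr_ge0 (K 0)).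
by exists 0; rewrite //= normr0.
Qed.

Lemma norm_le_opnorm x : `|K x| <= opnorm K * `|x|.
Proof.
have [->|x0] := eqVneq x 0; first by rewrite linear0 !normr0 mulr0.
have nx : 0 < `|x| by rewrite normr_gt0.
have : `|K (`|x|^-1 *: x)| <= opnorm K.
  apply: (ub_le_sup has_sup_opnorm.2); exists (`|x|^-1 *: x) => //=.
  by rewrite normrZ ger0_norm ?invr_ge0// mulVf// gt_eqF.
by rewrite linearZ /= normrZ ger0_norm ?invr_ge0// mulrC ler_pdivrMr.
Qed.

End operator_norm.

(** * Existence and optimality condition of proximal points *)

Section proximal_operator.
Context {R : realType} {E : euclideanType R}.
Implicit Types (phi : E -> \bar R).

Lemma proper_fineK {phi w} : proper_function phi -> (phi w < +oo)%E ->
  phi w = (fine (phi w))%:E.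
Proof. by move=> [phiNy _] h; rewrite fineK// fin_numElt phiNy. Qed.

(** Sequential closedness of the epigraph: a real [r] strictly between [l] and [phi a] would
    eventually separate [t n] from [phi (u n)]. *)
Lemma lsc_le_lim phi (u : nat -> E) a (t : nat -> R) l :
  lower_semicontinuous phi ->
  u n @[n --> \oo] --> a -> t n @[n --> \oo] --> l ->
  (forall n, phi (u n) <= (t n)%:E)%E -> (phi a <= l%:E)%E.
Proof.
move=> phi_lsc ua tl ut; rewrite leNgt; apply/negP => lphi.
have [r lr rphi] : exists2 r, l < r & (r%:E < phi a)%E.
  case: (phi a) lphi => [v| |] //; rewrite ?lte_fin.
    by move=> lv; exists ((l + v) / 2); rewrite ?lte_fin; lra.
  by move=> _; exists (l + 1); rewrite ?ltry ?ltrDl.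
have [V aV hV] := phi_lsc _ _ rphi.
have [n [Vn tn]] : exists n, V (u n) /\ t n < r.
  near \oo => n; exists n; split; near: n.
    exact: ua.
  exact: (cvgr_lt _ tl).
have := lt_le_trans (hV _ Vn) (ut n); rewrite lte_fin => rt.
by have := lt_trans rt tn; rewrite ltxx.
Unshelve. all: by end_near. Qed.

Variable phi : E -> \bar R.
Hypotheses (phi_convex : econvex phi) (phi_proper : proper_function phi)
  (phi_lsc : lower_semicontinuous phi).

(* Lower semicontinuity at a point z of the domain bounds phi below on a ball
   around z; convexity along the segments from z extends this linearly. *)
Lemma econvex_norm_minorant : exists (z : E) (c q : R),
  (phi z < +oo)%E /\ forall w, ((c - q * `|w - z|)%:E <= phi w)%E.
Proof.
have [phiNy [z zfin]] := phi_proper.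
have phizE := proper_fineK phi_proper zfin; set c := fine (phi z) in phizE.
have /phi_lsc [V zV hV] : ((c - 1)%:E < phi z)%E by rewrite phizE lte_fin; lra.
have /nbhs_normP [e /= e0 eV] := zV.
exists z, (c - 1), (2 / e); split=> // w.
have [we|ew] := ltP `|w - z| e.
  have : V w by apply: eV; rewrite /ball_ /= distrC.
  move=> /hV /ltW; apply: le_trans.
  by rewrite lee_fin lerBlDr lerDl mulr_ge0// divr_ge0// ltW.
have [wy|wfin] := leP +oo%E (phi w); first by apply: le_trans wy; rewrite leey.
rewrite (proper_fineK phi_proper wfin) lee_fin; set v := fine _.
(* This [t] puts [t *: w + (1 - t) *: z] at distance [e / 2] from [z], where [phi] exceeds [c - 1].
   Convexity then gives [v > c - t^-1], and [t^-1 = 2 / e * d] explains the slope. *)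
pose d := `|w - z|; pose t := e / 2 / d.
have d0 : 0 < d by exact: lt_le_trans ew.
have t0 : 0 < t by rewrite !divr_gt0.
have t1 : t <= 1 by rewrite ler_pdivrMr// mul1r /d; lra.
have : V (t *: w + (1 - t) *: z).
  apply: eV; rewrite /ball_ /= distrC.
  have -> : t *: w + (1 - t) *: z - z = t *: (w - z).
    by rewrite scalerBl scale1r scalerBr addrA addrAC addrK.
  by rewrite normrZ gtr0_norm// divfK ?gt_eqF//; lra.
move=> /hV /lt_le_trans /(_ (phi_convex _ _ _ _)).
rewrite phizE (proper_fineK phi_proper wfin) -!EFinM -EFinD lte_fin -/v.
rewrite (ltW t0) t1 => /(_ isT) h.
rewrite -/d; have -> : 2 / e * d = t^-1.
  by rewrite /t invfM invf_div invrK; field; rewrite gt_eqF.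
have : 0 < t * (v - c + t^-1) by rewrite mulrDr mulfV ?gt_eqF//; lra.
by rewrite pmulr_rgt0//; lra.
Qed.

(** Direct method: the quadratic term dominates the minorant of [phi], which is linear in the
    distance, so a minimizing sequence is bounded and lower semicontinuity makes a cluster point of
    it optimal. *)
Lemma prox_argmin_nonempty (gamma : R) x : 0 < gamma ->
  prox_argmin gamma phi x !=set0.
Proof.
move=> gamma0; have [phiNy _] := phi_proper.
have [z [c [q [zfin hw]]]] := econvex_norm_minorant.
pose J w : \bar R := (gamma%:E * phi w + (`|x - w| ^+ 2 / 2)%:E)%E.
(* Half of the quadratic term absorbs the linear one, because
   [(|x - w| / 2 - gamma * |q|) ^+ 2 >= 0]; the other half remains in [JC]. *)
pose C : R := gamma * (c - `|q| * `|x - z|) - (gamma * `|q|) ^+ 2.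
have JC w : ((C + `|x - w| ^+ 2 / 4)%:E <= J w)%E.
  have h : ((gamma * (c - q * `|w - z|) + `|x - w| ^+ 2 / 2)%:E <= J w)%E.
    by rewrite EFinD leeD2r// EFinM lee_pmul2l.
  apply: le_trans h; rewrite lee_fin.
  have h1 : `|w - z| <= `|x - w| + `|x - z| by rewrite (distrC x w) ler_distD.
  have h2 : q * `|w - z| <= `|q| * (`|x - w| + `|x - z|).
    apply: le_trans (ler_norm _) _; rewrite normrM normr_id.
    by rewrite ler_wpM2l.
  have h3 : gamma * (q * `|w - z|) <= gamma * (`|q| * (`|x - w| + `|x - z|)).
    by rewrite ler_pM2l.
  have := sqr_ge0 (`|x - w| / 2 - gamma * `|q|); rewrite /C; lra.
pose S := [set J w | w in [set: E]].
have Sm : ereal_inf S \is a fin_num.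
  rewrite fin_numElt; apply/andP; split.
    apply: (@lt_le_trans _ _ C%:E); first exact: ltNyr.
    apply: le_ereal_inf_tmp => _ [w _ <-]; apply: le_trans (JC w).
    by rewrite lee_fin lerDl divr_ge0// sqr_ge0.
  apply: (@le_lt_trans _ _ (J z)); first by apply: ereal_inf_lbound; exists z.
  by rewrite /J (proper_fineK phi_proper zfin) -EFinM -EFinD ltry.
have [m mE] : exists m, ereal_inf S = m%:E.
  by exists (fine (ereal_inf S)); rewrite fineK.
have ex k : exists w, (J w < (m + k.+1%:R^-1)%:E)%E.
  have k0 : 0 < k.+1%:R^-1 :> R by rewrite invr_gt0.
  have [_ [w _ <-]] := lb_ereal_inf_adherent k0 Sm.
  by rewrite mE -EFinD => h; exists w.
have [w hJ] := choice ex.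
have [s [a [sk sa]]] : exists (s : nat -> nat) (a : E), (forall k, (k <= s k)%N) /\
     w (s k) @[k --> \oo] --> a.
  apply: (@bounded_seq_cvg_subseq _ _ _ (`|x| + (1 + 4 * (m + 1 - C)))) => k.
  have := le_lt_trans (JC (w k)) (hJ k); rewrite lte_fin.
  have k1 : k.+1%:R^-1 <= 1 :> R by rewrite invf_le1// ler1n.
  have -> : `|w k| = `|x - (x - w k)| by rewrite opprB addrC subrK.
  move=> h; apply: le_trans (ler_normB _ _) _; rewrite lerD2l.
  move: C {JC} h => C h; set d := `|x - w k| in h *.
  by have := sqr_ge0 (d - 1 / 2); move: (k.+1%:R^-1 : R) k1 h => r k1 h; lra.
(* The bound on [J] is solved for [phi], so that lower semicontinuity is applied to [phi] alone and
   the quadratic term passes to the limit by continuity. *)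
have phia : (phi a <= ((m - `|x - a| ^+ 2 / 2) / gamma)%:E)%E.
  apply: (@lsc_le_lim phi (w \o s) a
    (fun k => (m + k.+1%:R^-1 - `|x - w (s k)| ^+ 2 / 2) / gamma)) => //.
    apply: cvgM; last exact: cvg_cst.
    apply: cvgB.
      by rewrite -[X in _ --> X]addr0; apply: cvgD; [exact: cvg_cst | exact: cvg_harmonic].
    apply: cvgM; last exact: cvg_cst.
    by apply: cvgM; apply: cvg_norm; apply: cvgB => //; exact: cvg_cst.
  move=> k; have Jk : (J (w (s k)) <= (m + k.+1%:R^-1)%:E)%E.
    apply: le_trans (ltW (hJ _)) _; rewrite lee_fin lerD2l.
    by rewrite lef_pV2 ?posrE// ler_nat ltnS sk.
  have wfin : (phi (w (s k)) < +oo)%E.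
    rewrite ltNge leye_eq; apply/negP => /eqP phiy; move: Jk.
    by rewrite /J phiy gt0_muley ?lte_fin// addye.
  move: Jk; rewrite /J /= (proper_fineK phi_proper wfin) -EFinM -EFinD !lee_fin.
  by rewrite ler_pdivlMr// (mulrC _ gamma) lerBrDr.
have afin : (phi a < +oo)%E by apply: le_lt_trans phia _; rewrite ltry.
exists a => v; apply: (@le_trans _ _ m%:E); last first.
  by rewrite -mE; apply: ereal_inf_lbound; exists v.
move: phia; rewrite (proper_fineK phi_proper afin) -EFinM -EFinD !lee_fin.
by rewrite ler_pdivlMr// (mulrC _ gamma); lra.
Qed.

(** Fermat's rule: [(x - p) / gamma] is a subgradient of [phi] at the minimizer [p]. *)
Lemma prox_variational (gamma : R) x (p := prox gamma phi x) : 0 < gamma ->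
  (phi p < +oo)%E /\
  forall w, (phi p + (inner (x - p) (w - p) / gamma)%:E <= phi w)%E.
Proof.
move=> gamma0; have [phiNy [z zfin]] := phi_proper.
have pmin : prox_argmin gamma phi x p := xgetPex 0 (prox_argmin_nonempty _ _ gamma0).
have pfin : (phi p < +oo)%E.
  rewrite ltNge leye_eq; apply/negP => /eqP phiy; have := pmin z.
  by rewrite phiy gt0_muley ?lte_fin// addye// (proper_fineK phi_proper zfin).
split=> // w.
have [wy|wfin] := leP +oo%E (phi w); first by apply: le_trans wy; rewrite leey.
(* Compare the minimizer p with t w + (1 - t) p, then let t tend to 0. *)
have key (t : R) : 0 < t -> t <= 1 ->
    0 <= gamma * (fine (phi w) - fine (phi p)) - inner (x - p) (w - p)
         + t * (`|w - p| ^+ 2 / 2).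
  move=> t0 t1; rewrite -(pmulr_rge0 _ t0).
  have hc : (phi (t *: w + (1 - t) *: p)%R <=
             (t * fine (phi w) + (1 - t) * fine (phi p))%:E)%E.
    rewrite EFinD !EFinM -!proper_fineK//; apply: phi_convex.
    by rewrite (ltW t0).
  have cfin := le_lt_trans hc (ltry _).
  have := pmin (t *: w + (1 - t) *: p).
  move: hc; rewrite (proper_fineK phi_proper cfin) (proper_fineK phi_proper pfin).
  rewrite -!EFinM -!EFinD !lee_fin => hc.
  have -> : x - (t *: w + (1 - t) *: p) = (x - p) - t *: (w - p).
    rewrite scalerBl scale1r scalerBr !opprD !opprK !addrA.
    by congr (_ + _); exact: addrAC.
  rewrite (sqr_normB (x - p)) innerZr normrZ exprMn gtr0_norm// => hp.
  have hcg : gamma * fine (phi (t *: w + (1 - t) *: p)) <=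
    gamma * (t * fine (phi w) + (1 - t) * fine (phi p)) by rewrite ler_pM2l.
  lra.
rewrite (proper_fineK phi_proper wfin) (proper_fineK phi_proper pfin).
rewrite -EFinD lee_fin -lerBrDl ler_pdivrMr// -subr_ge0 mulrC.
set a : R := gamma * _ - _ in key *; rewrite leNgt; apply/negP => a0.
set D : R := _ / 2 in key; have D0 : 0 <= D by rewrite divr_ge0// sqr_ge0.
have Da : 0 < D + 1 - a by lra.
(* An explicit small [t] stands in for the limit: it lies in (0, 1], and
   [a + t * D = a * (1 - a) / (D + 1 - a)] is negative when [a < 0]. *)
have := key (- a / (D + 1 - a)).
rewrite ler_pdivrMr// divr_gt0 ?oppr_gt0// => /(_ isT).
rewrite mul1r -(pmulr_rge0 _ Da) mulrDr.
have -> : (D + 1 - a) * (- a / (D + 1 - a) * D) = - a * D.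
  by field; rewrite gt_eqF.
have := mulr_gt0 (_ : 0 < - a) (_ : 0 < - a).
by rewrite oppr_gt0 => /(_ a0 a0); nra.
Qed.

End proximal_operator.

(** * The conjugate is proper, convex and lower semicontinuous *)

Section conjugate.
Context {R : realType} {E : euclideanType R} (f : E -> \bar R).
Hypotheses (f_convex : econvex f) (f_proper : proper_function f)
  (f_lsc : lower_semicontinuous f).
Local Open Scope ereal_scope.

Lemma conjugate_proper : proper_function (conjugate f).
Proof.
have [fNy [z zfin]] := f_proper; split=> [u|].
  apply: (@lt_le_trans _ _ ((inner z u)%:E - f z)); last first.
    by apply: ereal_sup_ubound; exists z.
  by rewrite (proper_fineK f_proper zfin) -EFinB ltNyr.
have [pfin hp] := prox_variational _ f_convex f_proper f_lsc 1%R 0%R ltr01.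
set p := prox _ _ _ in pfin hp.
(* With p := prox_f 0, the vector -p is a subgradient of f at p. *)
exists (- p)%R; apply: (@le_lt_trans _ _ ((inner p (- p))%:E - f p)); last first.
  by rewrite (proper_fineK f_proper pfin) -EFinB ltry.
apply: ge_ereal_sup => _ [w _ <-]; have := hp w.
have [wy _|wfin] := leP +oo (f w).
  by move: wy; rewrite leye_eq => /eqP ->; rewrite addeNy leNye.
rewrite (proper_fineK f_proper pfin) (proper_fineK f_proper wfin).
rewrite -EFinD -!EFinB !lee_fin sub0r divr1 innerBr.
rewrite (innerC (- p)%R w) (innerC (- p)%R p).
lra.
Qed.

Lemma conjugate_convex : econvex (conjugate f).
Proof.
move=> u v t /andP[t0 t1]; apply: ge_ereal_sup => _ [z _ <-].
have [zy|zfin] := leP +oo (f z).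
  by move: zy; rewrite leye_eq => /eqP ->; rewrite addeNy leNye.
apply: (@le_trans _ _ (t%:E * ((inner z u)%:E - f z) +
                       (1 - t)%:E * ((inner z v)%:E - f z))).
  rewrite (proper_fineK f_proper zfin) -!EFinB -!EFinM -EFinD lee_fin.
  by rewrite innerDr !innerZr; lra.
by apply: leeD; apply: lee_wpmul2l; rewrite ?lee_fin ?subr_ge0//;
  apply: ereal_sup_ubound; exists z.
Qed.

(** The conjugate is a supremum of affine functions: one whose value at [u] exceeds [a] still
    exceeds [a] near [u]. *)
Lemma conjugate_lsc : lower_semicontinuous (conjugate f).
Proof.
move=> u a /ereal_sup_gt [_ [z _ <-]].
have [zy|zfin] := leP +oo (f z).
  by move: zy; rewrite leye_eq => /eqP ->; rewrite addeNy.
rewrite (proper_fineK f_proper zfin) -EFinB lte_fin => au.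
exists [set v | (a < inner z v - fine (f z))%R] => [|v /= av]; last first.
  apply: (@lt_le_trans _ _ ((inner z v)%:E - f z)); last first.
    by apply: ereal_sup_ubound; exists z.
  by rewrite (proper_fineK f_proper zfin) -EFinB lte_fin.
(* Radius given by Cauchy-Schwarz; the [+ 1] keeps the denominator positive when [z = 0]. *)
have e0 : (0 < (inner z u - fine (f z) - a) / (`|z| + 1))%R.
  by apply: divr_gt0; [rewrite subr_gt0 | rewrite ltr_wpDl].
have : id v @[v --> u] --> u by exact: cvg_id.
move=> /cvgr_dist_lt /(_ _ e0); apply: filterS => v /=.
rewrite ltr_pdivlMr; last by rewrite ltr_wpDl.
move=> h.
have := inner_le_norm z (u - v)%R; rewrite innerBr.
have := normr_ge0 (u - v)%R; nra.
Qed.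

End conjugate.

(** * Jensen's inequality for averages *)

Section averages.
Context {R : realType} {E : euclideanType R}.

(** By induction: the mean of [N.+2] terms is a convex combination of the mean of the first [N.+1],
    with weight [N.+1 / N.+2], and the last term. Finiteness is asked from index 1 on, as a starting
    point may lie outside the domain. *)
Lemma average_jensen (phi : E -> \bar R) (u : nat -> E) (N : nat) :
  econvex phi -> proper_function phi ->
  (forall n, phi (u n.+1) < +oo)%E ->
  (phi (average u N.+1) <=
     (N.+1%:R^-1 * \sum_(1 <= n < N.+2) fine (phi (u n)))%:E)%E.
Proof.
move=> phi_convex phi_proper ufin; rewrite /average.
elim: N => [|N IH].
  by rewrite !big_nat1 invr1 scale1r mul1r -proper_fineK.
set A := N.+1%:R^-1 *: _ in IH.
pose t : R := N.+1%:R / N.+2%:R.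
have N2 : (N.+2%:R : R) != 0 by rewrite pnatr_eq0.
have N1 : (N.+1%:R : R) != 0 by rewrite pnatr_eq0.
have tc : 1 - t = N.+2%:R^-1.
  by rewrite /t -[X in X - _](divff N2) -mulrBl -natrB// subSnn div1r.
have -> : N.+2%:R^-1 *: \sum_(1 <= n < N.+3) u n = t *: A + (1 - t) *: u N.+2.
  by rewrite big_nat_recr//= tc scalerDr /A scalerA /t mulrAC divff// mul1r.
apply: le_trans (phi_convex _ _ _ _) _.
  by rewrite divr_ge0// /t ler_pdivrMr ?ltr0n// mul1r ler_nat leqnSn.
rewrite (big_nat_recr N.+2)//= mulrDr [X in (_ <= X)%E]EFinD -tc.
rewrite [X in (_ <= _ + X)%E]EFinM -proper_fineK// leeD2r//.
have -> : ((1 - t) * \sum_(1 <= i < N.+2) fine (phi (u i)))%R =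
  t * (N.+1%:R^-1 * \sum_(1 <= i < N.+2) fine (phi (u i))).
  by rewrite tc /t [in RHS]mulrA; congr (_ * _); rewrite mulrAC divff// mul1r.
by rewrite [leRHS]EFinM; apply: lee_wpmul2l => //; rewrite lee_fin divr_ge0.
Qed.

End averages.

(** If [ereal_inf B] is [+oo] or [ereal_sup A] is [-oo], the difference is [-oo]. Otherwise an
    element [b < +oo] of [B] bounds the supremum, and the supremum then bounds the infimum from
    below, so both are real. *)
Lemma sup_sub_inf_le {R : realType} (A B : set (\bar R)) (c : R) :
  (forall a b, A a -> B b -> a - b <= c%:E)%E ->
  (ereal_sup A - ereal_inf B <= c%:E)%E.
Proof.
move=> hAB.
have [->|/eqP infB] := eqVneq (ereal_inf B) +oo%E; first by rewrite addeNy leNye.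
have [->|/eqP supA] := eqVneq (ereal_sup A) -oo%E; first by rewrite addNye leNye.
have [b Bb boo] : exists2 b, B b & (b < +oo)%E.
  by apply: ereal_inf_lt; rewrite ltey; apply/eqP.
have [a Aa aNy] : exists2 a, A a & (-oo < a)%E.
  by apply: ereal_sup_gt; rewrite ltNye; apply/eqP.
(* In [\bar R], -oo absorbs +oo in a sum, so only pairs with -oo < a and
   b < +oo carry information. *)
have realAB a' b' : A a' -> B b' -> (-oo < a')%E -> (b' < +oo)%E ->
    exists r t : R, [/\ a' = r%:E, b' = t%:E & r - t <= c].
  move=> Aa' Bb'; have := hAB _ _ Aa' Bb'.
  by case: a' {Aa'} => [r| |]; case: b' {Bb'} => [t| |] //= h _ _; exists r, t.
have supA_le b' : B b' -> (b' < +oo)%E -> (ereal_sup A <= c%:E + b')%E.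
  move=> Bb' b'oo; apply: ge_ereal_sup => a' Aa'.
  have [a'N|a'N] := leP a' -oo%E; first by apply: le_trans a'N _; rewrite leNye.
  have [r [t [-> -> rt]]] := realAB _ _ Aa' Bb' a'N b'oo.
  by rewrite -EFinD lee_fin -lerBlDr.
have [r [t [aE bE rt]]] := realAB _ _ Aa Bb aNy boo.
have [S SE] : exists S, ereal_sup A = S%:E.
  exists (fine (ereal_sup A)); rewrite fineK// fin_numElt; apply/andP; split.
    by rewrite ltNye; apply/eqP.
  by apply: le_lt_trans (supA_le _ Bb boo) _; rewrite bE -EFinD ltry.
have infB_ge : ((S - c)%:E <= ereal_inf B)%E.
  apply: le_ereal_inf_tmp => b' Bb'.
  have [b'y|b'y] := leP +oo%E b'; first by apply: le_trans b'y; rewrite leey.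
  have := supA_le _ Bb' b'y; have [r' [t' [_ -> _]]] := realAB _ _ Aa Bb' aNy b'y.
  by rewrite SE -EFinD !lee_fin lerBlDl.
move: infB_ge (ereal_inf_lbound Bb); rewrite SE bE.
by case: (ereal_inf B) => [i| |] //=; rewrite !lee_fin; lra.
Qed.

(** * Convergence of sequences *)

Section sequences.
Context {R : realType}.

Lemma cvg_subseq {T : topologicalType} (u : nat -> T) (a : T) (s : nat -> nat) :
  (forall n, (n <= s n)%N) -> u n @[n --> \oo] --> a ->
  u (s n) @[n --> \oo] --> a.
Proof.
move=> ns ua; apply: (cvg_comp _ _ _ ua) => A [N _ hN].
by exists N => // n /= Nn; apply: hN; exact: leq_trans Nn (ns n).
Qed.

Lemma sqr_norm_cvg0 {E : normedModType R} (u : nat -> E) :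
  `|u n| ^+ 2 @[n --> \oo] --> (0 : R) -> u n @[n --> \oo] --> (0 : E).
Proof.
move=> u0; apply: norm_cvg0.
have : Num.sqrt (`|u n| ^+ 2) @[n --> \oo] --> Num.sqrt (0 : R).
  by apply: continuous_cvg => //; exact: sqrt_continuous.
by rewrite sqrtr0; under eq_fun do rewrite sqrtr_sqr normr_id.
Qed.

(** [V] is nonincreasing and bounded below, hence convergent, and its vanishing decrements dominate
    [k * d n]. *)
Lemma telescoping_cvg0 (V d : nat -> R) (k : R) : 0 < k ->
  (forall n, 0 <= V n) -> (forall n, 0 <= d n) ->
  (forall n, V n.+1 + k * d n <= V n) -> d n @[n --> \oo] --> (0 : R).
Proof.
move=> k0 V0 d0 hV.
have Vcvg : cvgn V.
  apply: nonincreasing_is_cvgn; last by exists 0 => _ [n _ <-].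
  apply/nonincreasing_seqP => n; apply: le_trans (hV n).
  by rewrite lerDl mulr_ge0// ltW.
have h : k^-1 * (V n - V n.+1) @[n --> \oo] --> (0 : R).
  rewrite -[X in _ --> X](mulr0 k^-1) -(subrr (limn V)).
  apply: cvgM; first exact: cvg_cst.
  by apply: cvgB => //; rewrite (cvg_shiftS V).
apply: (@squeeze_cvgr _ _ _ _ (fun=> 0) _ _ _ _ _ h); last exact: cvg_cst.
by near=> n; rewrite d0 /= mulrC ler_pdivlMr// mulrC lerBrDl.
Unshelve. all: by end_near. Qed.

(** The inequality [d <= d ^+ 2 + 1] replaces a square root; only boundedness matters. *)
Lemma seq_norm_le (G : euclideanType R) (u : nat -> G) (p : G) (t C : R) :
  0 < t -> (forall n, `|u n - p| ^+ 2 / (2 * t) <= C) ->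
  forall n, `|u n| <= `|p| + (1 + 2 * t * C).
Proof.
move=> t0 hC n; have := hC n; rewrite ler_pdivrMr ?mulr_gt0//.
have : `|u n| <= `|u n - p| + `|p| by rewrite -{1}(subrK p (u n)) ler_normD.
have := sqr_ge0 (`|u n - p| - 1 / 2).
by move: (`|u n - p|) (`|u n|) (`|p|) => d e r; nra.
Qed.

End sequences.

(** * The primal-dual iteration *)

Section primal_dual.
Context {R : realType} {E F : euclideanType R}.
Variables (f : F -> \bar R) (g : E -> \bar R).
Hypotheses (f_convex : econvex f) (f_proper : proper_function f)
  (f_lsc : lower_semicontinuous f) (g_convex : econvex g)
  (g_proper : proper_function g) (g_lsc : lower_semicontinuous g).
Variables (K : {linear E -> F}) (Kadj : {linear F -> E}).
Hypothesis (K_adjoint : is_adjoint K Kadj).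

Local Notation fs := (conjugate f).
Let fs_proper := conjugate_proper _ f_convex f_proper f_lsc.
Let fs_convex := conjugate_convex _ f_proper.
Let fs_lsc := conjugate_lsc _ f_proper.

(** The real-valued form of optimality: [- Kadj v] is a subgradient of [g] at [w], and [K w] is one
    of [fs] at [v]. *)
Lemma saddle_pointP w v : saddle_point K f g w v <->
  [/\ (g w < +oo)%E, (fs v < +oo)%E,
      forall w', (g w' < +oo)%E ->
        fine (g w) <= fine (g w') + inner (K (w' - w)) v &
      forall v', (fs v' < +oo)%E ->
        fine (fs v) <= fine (fs v') + inner (K w) (v - v')].
Proof.
have [gNy [w1 w1fin]] := g_proper; have [fsNy [v1 v1fin]] := fs_proper.
split=> [sp|[wfin vfin hw hv] w' v']; last first.
  rewrite /lagrangian (proper_fineK g_proper wfin) (proper_fineK fs_proper vfin).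
  rewrite -EFinD -?EFinB; split.
    have [v'y|v'fin] := leP +oo%E (fs v').
      by move: v'y; rewrite leye_eq => /eqP ->; rewrite addeNy leNye.
    rewrite (proper_fineK fs_proper v'fin) -EFinB lee_fin.
    by have := hv _ v'fin; rewrite innerBr; lra.
  have [w'y|w'fin] := leP +oo%E (g w').
    by move: w'y; rewrite leye_eq => /eqP ->; rewrite addey// addye// leey.
  rewrite (proper_fineK g_proper w'fin) -EFinD -?EFinB lee_fin.
  by have := hw _ w'fin; rewrite linearB innerBl; lra.
(* Otherwise the saddle value would be [-oo], below [lagrangian w v1], which properness of [g] keeps
   above [-oo]. Once [fs v] is finite, [g w = +oo] is excluded by comparison with [w1]. *)
have vfin : (fs v < +oo)%E.
  rewrite ltNge leye_eq; apply/negP => /eqP vy.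
  have [+ _] := sp w v1; rewrite /lagrangian vy addeNy leeNy_eq.
  by rewrite (proper_fineK fs_proper v1fin); move: (gNy w); case: (g w).
have wfin : (g w < +oo)%E.
  rewrite ltNge leye_eq; apply/negP => /eqP wy.
  have [_ +] := sp w1 v1; rewrite /lagrangian wy.
  by rewrite (proper_fineK fs_proper vfin) (proper_fineK g_proper w1fin).
split=> // [w' w'fin|v' v'fin].
  have [_ +] := sp w' v1; rewrite /lagrangian (proper_fineK g_proper wfin).
  rewrite (proper_fineK fs_proper vfin) (proper_fineK g_proper w'fin).
  by rewrite -!EFinD -?EFinB lee_fin linearB innerBl; lra.
have [+ _] := sp w1 v'; rewrite /lagrangian (proper_fineK g_proper wfin).
rewrite (proper_fineK fs_proper vfin) (proper_fineK fs_proper v'fin).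
by rewrite -!EFinD -?EFinB lee_fin innerBr; lra.
Qed.

Variables (sigma tau : R).
Hypotheses (sigma_gt0 : 0 < sigma) (tau_gt0 : 0 < tau)
  (step_lt1 : tau * sigma * opnorm K ^+ 2 < 1).
Variables (x : nat -> E) (y : nat -> F).
(* Since 0.-1 = 0, this encodes the convention x_{-1} = x_0, for which the
   extrapolated point is 2 x_n - x_{n-1} for every n. *)
Hypotheses
  (y_step : forall n, y n.+1 =
     prox sigma fs (y n + sigma *: K (2 *: x n - x n.-1)))
  (x_step : forall n, x n.+1 = prox tau g (x n - tau *: Kadj (y n.+1))).

Let rho : R := tau * sigma * opnorm K ^+ 2.
Let s : R := Num.sqrt rho.
Let dist2 w v n : R := `|y n - v| ^+ 2 / (2 * sigma) + `|x n - w| ^+ 2 / (2 * tau).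
Let a n : R := `|x n - x n.-1| ^+ 2 / (2 * tau).
Let b n : R := `|y n.+1 - y n| ^+ 2 / (2 * sigma).
Let c v n : R := inner (K (x n - x n.-1)) (y n - v).
Let gap w v n : R :=
  (inner (K (x n)) v - fine (fs v) + fine (g (x n)))
  - (inner (K w) (y n) - fine (fs (y n)) + fine (g w)).
Let V w v n : R := dist2 w v n + c v n + s * a n.

Let rho_ge0 : 0 <= rho.
Proof. by rewrite !mulr_ge0 ?exprn_ge0 ?opnorm_ge0// ltW. Qed.

Let s_ge0 : 0 <= s. Proof. exact: sqrtr_ge0. Qed.

Let s_sqr : s ^+ 2 = rho. Proof. by rewrite sqr_sqrtr. Qed.

Let s_lt1 : s < 1.
Proof. by rewrite -sqrtr1 ltr_sqrt// ltr01. Qed.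

Let a_ge0 n : 0 <= a n.
Proof. by rewrite divr_ge0 ?sqr_ge0// mulr_ge0// ltW. Qed.

Let b_ge0 n : 0 <= b n.
Proof. by rewrite divr_ge0 ?sqr_ge0// mulr_ge0// ltW. Qed.

Let dist2_ge0 w v n : 0 <= dist2 w v n.
Proof. by rewrite addr_ge0// divr_ge0 ?sqr_ge0// mulr_ge0// ltW. Qed.

(** * Bounds on the coupling term *)

Let inner_le_opnorm e d : `|inner (K e) d| <= opnorm K * `|e| * `|d|.
Proof.
by apply: le_trans (norm_inner_le _ _) _; rewrite ler_wpM2r// norm_le_opnorm.
Qed.

(** With [p] and [q] the two quotients on the right, [opnorm K * |e| * |d|] equals
    [2 * s * sqrt (p * q)]; the squared inequality is then the arithmetic-geometric one. *)
Let young e d : `|inner (K e) d| <=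
  s * (`|e| ^+ 2 / (2 * tau) + `|d| ^+ 2 / (2 * sigma)).
Proof.
apply: le_trans (inner_le_opnorm _ _) _.
have p0 : 0 <= `|e| ^+ 2 / (2 * tau) by rewrite divr_ge0 ?sqr_ge0// mulr_ge0// ltW.
have q0 : 0 <= `|d| ^+ 2 / (2 * sigma) by rewrite divr_ge0 ?sqr_ge0// mulr_ge0// ltW.
rewrite -(ler_pXn2r (n := 2))// ?nnegrE ?mulr_ge0 ?addr_ge0 ?opnorm_ge0//.
rewrite [leRHS]exprMn s_sqr.
have -> : (opnorm K * `|e| * `|d|) ^+ 2 =
    rho * (4 * (`|e| ^+ 2 / (2 * tau)) * (`|d| ^+ 2 / (2 * sigma))).
  by rewrite /rho; field; rewrite !gt_eqF.
rewrite ler_wpM2l//.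
have := sqr_ge0 (`|e| ^+ 2 / (2 * tau) - `|d| ^+ 2 / (2 * sigma)).
move: (`|e| ^+ 2 / (2 * tau)) (`|d| ^+ 2 / (2 * sigma)) => p q; nra.
Qed.

(** An unbalanced splitting: full weight on the primal quotient lowers the dual factor from [s] to
    [rho = s ^+ 2], the source of [1 - rho] in the first claim. *)
Let young_sharp e d : `|inner (K e) d| <=
  `|e| ^+ 2 / (2 * tau) + rho * (`|d| ^+ 2 / (2 * sigma)).
Proof.
apply: le_trans (inner_le_opnorm _ _) _; rewrite -subr_ge0.
have -> : `|e| ^+ 2 / (2 * tau) + rho * (`|d| ^+ 2 / (2 * sigma))
    - opnorm K * `|e| * `|d| = (`|e| - tau * opnorm K * `|d|) ^+ 2 / (2 * tau).
  by rewrite /rho; field; rewrite !gt_eqF.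
by rewrite divr_ge0 ?sqr_ge0// mulr_ge0// ltW.
Qed.

(** * Variational inequalities of the proximal steps and energy descent *)

Lemma primal_fin n : (g (x n.+1) < +oo)%E.
Proof.
rewrite x_step.
by have [] := prox_variational _ g_convex g_proper g_lsc tau
  (x n - tau *: Kadj (y n.+1)) tau_gt0.
Qed.

Lemma dual_fin n : (fs (y n.+1) < +oo)%E.
Proof.
rewrite y_step.
by have [] := prox_variational _ fs_convex fs_proper fs_lsc sigma
  (y n + sigma *: K (2 *: x n - x n.-1)) sigma_gt0.
Qed.

Lemma primal_variational n w : (g w < +oo)%E ->
  fine (g (x n.+1)) + inner (x n - x n.+1) (w - x n.+1) / tau
  - inner (K (w - x n.+1)) (y n.+1) <= fine (g w).
Proof.
move=> wfin; have [_ /(_ w)] := prox_variational _ g_convex g_proper g_lsc tau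
  (x n - tau *: Kadj (y n.+1)) tau_gt0.
rewrite -x_step (proper_fineK g_proper wfin) (proper_fineK g_proper (primal_fin n)).
rewrite -EFinD lee_fin; apply: le_trans; rewrite -addrA lerD2l.
have -> : x n - tau *: Kadj (y n.+1) - x n.+1 = x n - x n.+1 - tau *: Kadj (y n.+1).
  exact: addrAC.
rewrite (innerBl _ (tau *: _)) innerZl K_adjoint (innerC (Kadj _)).
by rewrite mulrBl (mulrC tau) mulfK// gt_eqF.
Qed.

Lemma dual_variational n v : (fs v < +oo)%E ->
  fine (fs (y n.+1)) + inner (y n - y n.+1) (v - y n.+1) / sigma
  + inner (K (2 *: x n - x n.-1)) (v - y n.+1) <= fine (fs v).
Proof.
move=> vfin; have [_ /(_ v)] := prox_variational _ fs_convex fs_proper fs_lsc sigma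
  (y n + sigma *: K (2 *: x n - x n.-1)) sigma_gt0.
rewrite -y_step (proper_fineK fs_proper vfin) (proper_fineK fs_proper (dual_fin n)).
rewrite -EFinD lee_fin; apply: le_trans; rewrite -addrA lerD2l.
set k := K _; have -> : y n + sigma *: k - y n.+1 = y n - y n.+1 + sigma *: k.
  exact: addrAC.
rewrite (innerDl _ (sigma *: _)) innerZl.
by rewrite mulrDl (mulrC sigma) mulfK// gt_eqF.
Qed.

(* The extrapolation makes the coupling terms telescope, up to
   <K (x_n - x_{n-1}), y_{n+1} - y_n>, which [young] absorbs. *)
Let descent w v n : (g w < +oo)%E -> (fs v < +oo)%E ->
  gap w v n.+1 + dist2 w v n.+1 + c v n.+1 + a n.+1 + (1 - s) * b n <= V w v n.
Proof.
move=> wfin vfin.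
have KB p q : K (p - q) = K p - K q by exact: linearB.
have K2 p : K (2 *: p) = 2 *: K p by exact: linearZ.
have := primal_variational n w wfin; have := dual_variational n v vfin.
have := le_trans (ler_norm _) (young (x n - x n.-1) (y n.+1 - y n)).
rewrite !three_point// /gap /V /dist2 /a /b /c /=.
rewrite !KB K2 !(innerBl, innerBr, innerZl).
lra.
Qed.

(** [young_sharp] spends all of [a n] on the coupling term. *)
Let W_ge w v n : (1 - rho) * dist2 w v n <= dist2 w v n + c v n + a n.
Proof.
have := young_sharp (x n - x n.-1) (y n - v); rewrite ler_norml => /andP[h _].
have : 0 <= rho * (`|x n - w| ^+ 2 / (2 * tau)).
  by rewrite mulr_ge0// divr_ge0 ?sqr_ge0// mulr_ge0// ltW.
by move: h; rewrite /c /a /dist2; lra.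
Qed.

(** [young] spends exactly the share [s * a n] contained in [V]. *)
Let V_ge w v n : (1 - s) * dist2 w v n <= V w v n.
Proof.
have := young (x n - x n.-1) (y n - v); rewrite ler_norml => /andP[h _].
have : 0 <= s * (`|x n - w| ^+ 2 / (2 * tau)).
  by rewrite mulr_ge0// divr_ge0 ?sqr_ge0// mulr_ge0// ltW.
by move: h; rewrite /V /c /a /dist2; lra.
Qed.

(** Telescopes [descent]. The full [a N] is kept on the left, as [W_ge] requires; it dominates the
    [s * a N] of the next step. *)
Let sum_gap w v N : (g w < +oo)%E -> (fs v < +oo)%E ->
  \sum_(1 <= n < N.+1) gap w v n + (dist2 w v N + c v N + a N) <= dist2 w v 0%N.
Proof.
move=> wfin vfin; elim: N => [|N IH].
  (* Since [0.-1 = 0], both [c] and [a] vanish at index 0. *)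
  by rewrite big_nil /c /a /= !subrr linear0 inner0l normr0 expr0n /= mul0r !addr0 add0r.
rewrite big_nat_recr//=; have := descent w v N wfin vfin; rewrite /V.
have : s * a N <= a N by rewrite ler_piMl// ltW.
have : 0 <= (1 - s) * b N by rewrite mulr_ge0// subr_ge0 ltW.
by move: IH; lra.
Qed.

Let gap_ge0 w v n : saddle_point K f g w v -> 0 <= gap w v n.+1.
Proof.
move=> /saddle_pointP [wfin vfin hw hv].
have := hw _ (primal_fin n); have := hv _ (dual_fin n).
rewrite linearB innerBl innerBr /gap.
by lra.
Qed.

Lemma iterates_bounded w v n : saddle_point K f g w v ->
  `|y n - v| ^+ 2 / (2 * sigma) + `|x n - w| ^+ 2 / (2 * tau)
    <= (1 - tau * sigma * opnorm K ^+ 2)^-1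
       * (`|y 0%N - v| ^+ 2 / (2 * sigma) + `|x 0%N - w| ^+ 2 / (2 * tau)).
Proof.
move=> sp; have /saddle_pointP [wfin vfin _ _] := sp.
rewrite [leRHS]mulrC ler_pdivlMr ?subr_gt0// mulrC; apply: le_trans (W_ge w v n) _.
apply: le_trans (sum_gap w v n wfin vfin); rewrite lerDr.
by rewrite big_add1 sumr_ge0// => i _; exact: gap_ge0.
Qed.

(** Apart from [g] and [fs], the gap is affine in the iterates, so by Jensen its value at the
    averages is at most the mean of the gaps, which [sum_gap] bounds. *)
Lemma average_gap w v N : (g w < +oo)%E -> (fs v < +oo)%E ->
  [/\ (g (average x N.+1) < +oo)%E, (fs (average y N.+1) < +oo)%E &
  (inner v (K (average x N.+1)) - fine (fs v) + fine (g (average x N.+1)))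
  - (inner (average y N.+1) (K w) + fine (g w) - fine (fs (average y N.+1)))
  <= (`|x 0%N - w| ^+ 2 / (2 * tau) + `|y 0%N - v| ^+ 2 / (2 * sigma)) / N.+1%:R].
Proof.
move=> wfin vfin.
have hg := average_jensen _ _ N g_convex g_proper primal_fin.
have hf := average_jensen _ _ N fs_convex fs_proper dual_fin.
have gfin := le_lt_trans hg (ltry _); have ffin := le_lt_trans hf (ltry _).
split=> //; move: hg hf.
rewrite (proper_fineK g_proper gfin) (proper_fineK fs_proper ffin) !lee_fin => hg hf.
have N0 : 0 < N.+1%:R :> R by rewrite ltr0n.
have Kx : inner v (K (average x N.+1)) =
    N.+1%:R^-1 * \sum_(1 <= n < N.+2) inner (K (x n)) v.
  rewrite linearZ /= linear_sum innerZr inner_sumr.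
  by under eq_bigr do rewrite innerC.
have Ky : inner (average y N.+1) (K w) =
    N.+1%:R^-1 * \sum_(1 <= n < N.+2) inner (K w) (y n).
  by rewrite innerZl innerC inner_sumr.
have gapE : N.+1%:R^-1 * \sum_(1 <= n < N.+2) gap w v n =
  inner v (K (average x N.+1)) - fine (fs v)
   + N.+1%:R^-1 * \sum_(1 <= n < N.+2) fine (g (x n))
  - (inner (average y N.+1) (K w) + fine (g w)
     - N.+1%:R^-1 * \sum_(1 <= n < N.+2) fine (fs (y n))).
  rewrite /gap sumrB !big_split /= !sumrN !sumr_const_nat subSS subn0 Kx Ky.
  rewrite -(mulr_natr (fine (fs v))) -(mulr_natr (fine (g w))).
  by move: (N.+1%:R : R) N0 => r r0; field; rewrite gt_eqF.
have : N.+1%:R^-1 * \sum_(1 <= n < N.+2) gap w v n <=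
    (`|x 0%N - w| ^+ 2 / (2 * tau) + `|y 0%N - v| ^+ 2 / (2 * sigma)) / N.+1%:R.
  rewrite mulrC; apply: ler_wpM2r; first by rewrite invr_ge0 ltW.
  rewrite [leRHS]addrC.
  apply: le_trans (sum_gap w v N.+1 wfin vfin); rewrite lerDl.
  by apply: le_trans (W_ge w v N.+1); rewrite mulr_ge0// subr_ge0 ltW.
by apply: le_trans; rewrite gapE; apply: lerB; [rewrite lerD2l | rewrite lerD2l lerN2].
Qed.

Lemma partial_gap_bound N B1 B2 :
  (partial_gap K f g B1 B2 (average x N.+1) (average y N.+1)
   <= gap_constant tau sigma (x 0%N) (y 0%N) B1 B2 * (N.+1%:R^-1)%:E)%E.
Proof.
set D := gap_constant _ _ _ _ _ _.
have hD w v : B1 w -> B2 v ->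
    ((`|x 0%N - w| ^+ 2 / (2 * tau) + `|y 0%N - v| ^+ 2 / (2 * sigma))%:E <= D)%E.
  move=> Bw Bv; apply: ereal_sup_ubound; exists (w, v) => //=.
  by rewrite (distrC w) (distrC v).
have N0 : 0 < N.+1%:R^-1 :> R by rewrite invr_gt0.
(* For an empty set, the infimum [+oo] or the supremum [-oo] makes the gap [-oo]. *)
have [->|/set0P[w1 Bw1]] := eqVneq B1 set0.
  by rewrite /partial_gap image_set0 ereal_inf0 addeNy leNye.
have [->|/set0P[v1 Bv1]] := eqVneq B2 set0.
  by rewrite /partial_gap image_set0 ereal_sup0 addNye leNye.
have [Dy|Dfin] := leP +oo%E D.
  by move: Dy; rewrite leye_eq => /eqP ->; rewrite gt0_mulye ?lte_fin// leey.
have DE : D = (fine D)%:E.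
  by rewrite fineK// fin_numElt Dfin (lt_le_trans _ (hD _ _ Bw1 Bv1))// ltNyr.
rewrite DE -EFinM; apply: sup_sub_inf_le => _ _ [v Bv <-] [w Bw <-].
(* Any pair in the domains serves here: only finiteness at the averages is extracted. *)
have [w2 w2fin] := g_proper.2; have [v2 v2fin] := fs_proper.2.
have [gfin ffin _] := average_gap w2 v2 N w2fin v2fin.
rewrite (proper_fineK g_proper gfin) (proper_fineK fs_proper ffin).
have [vy|vfin] := leP +oo%E (fs v).
  by move: vy; rewrite leye_eq => /eqP ->; rewrite addeNy !addNye leNye.
have [wy|wfin] := leP +oo%E (g w).
  by move: wy; rewrite leye_eq => /eqP ->; rewrite addey// addye// addeNy leNye.
have [_ _ hgap] := average_gap w v N wfin vfin.
rewrite (proper_fineK g_proper wfin) (proper_fineK fs_proper vfin).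
rewrite -!EFinD -?EFinB lee_fin; apply: le_trans hgap _.
by apply: ler_wpM2r; [exact: ltW | rewrite -lee_fin -DE; exact: hD].
Qed.

(** * Convergence of the iterates *)

Let dx n := x n - x n.-1.
Let dy n := y n.+1 - y n.

Lemma steps_cvg0 w v : saddle_point K f g w v ->
  dx n @[n --> \oo] --> (0 : E) /\ dy n @[n --> \oo] --> (0 : F).
Proof.
move=> sp; have /saddle_pointP [wfin vfin _ _] := sp.
(* [descent] provides all of [a n.+1], while [V] at [n.+1] uses only [s * a n.+1]; this leaves
   [1 - s] times both [a n.+1] and [b n]. *)
have ab0 : (a n.+1 + b n) @[n --> \oo] --> (0 : R).
  apply: (@telescoping_cvg0 _ (V w v) _ (1 - s)); rewrite ?subr_gt0//.
  - by move=> n; apply: le_trans (V_ge w v n); rewrite mulr_ge0// subr_ge0 ltW.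
  - by move=> n; rewrite addr_ge0.
  - move=> n; apply: le_trans (descent w v n wfin vfin).
    by have := gap_ge0 w v n sp; rewrite /V; lra.
have norm2 (G : euclideanType R) (u : nat -> G) (t : R) : 0 < t ->
    (forall n, `|u n| ^+ 2 / (2 * t) <= a n.+1 + b n) ->
    u n @[n --> \oo] --> (0 : G).
  move=> t0 hu; apply: sqr_norm_cvg0.
  have h : 2 * t * (a n.+1 + b n) @[n --> \oo] --> (0 : R).
    by rewrite -[X in _ --> X](mulr0 (2 * t)); apply: cvgM => //; exact: cvg_cst.
  apply: (@squeeze_cvgr _ _ _ _ (fun=> 0) _ _ _ _ _ h); last exact: cvg_cst.
  near=> n; rewrite sqr_ge0 /= mulrC -ler_pdivrMr ?mulr_gt0//.
split; last by apply: (norm2 _ _ sigma) => // n; rewrite lerDr.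
rewrite -(cvg_shiftS dx); apply: (norm2 _ _ tau) => // n.
by rewrite lerDl.
Unshelve. all: by end_near. Qed.

(** Consecutive iterates share their limit along [k], so the terms with increments drop out of the
    two variational inequalities and the subgradient conditions of [saddle_pointP] remain. *)
Lemma limit_saddle_point (k : nat -> nat) w0 v0 xs ys :
  saddle_point K f g w0 v0 -> (forall n, (n <= k n)%N) ->
  x (k n) @[n --> \oo] --> xs -> y (k n) @[n --> \oo] --> ys ->
  saddle_point K f g xs ys.
Proof.
move=> sp hk xk yk; have [dx0 dy0] := steps_cvg0 _ _ sp.
have dxk := cvg_subseq _ _ _ hk dx0; have dyk := cvg_subseq _ _ _ hk dy0.
have dx1k : dx (k n).+1 @[n --> \oo] --> (0 : E).
  apply: (cvg_subseq dx _ (fun n => (k n).+1)) => // n.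
  exact: leq_trans (hk n) (leqnSn _).
have xk1 : x (k n).+1 @[n --> \oo] --> xs.
  have -> : (fun n => x (k n).+1) = (fun n => x (k n) + dx (k n).+1).
    by apply/funext => n; rewrite /dx /= addrC subrK.
  by rewrite -[xs]addr0; exact: cvgD.
have yk1 : y (k n).+1 @[n --> \oo] --> ys.
  have -> : (fun n => y (k n).+1) = (fun n => y (k n) + dy (k n)).
    by apply/funext => n; rewrite /dy addrC subrK.
  by rewrite -[ys]addr0; exact: cvgD.
have Kcvg (u : nat -> E) p : u n @[n --> \oo] --> p -> K (u n) @[n --> \oo] --> K p.
  by move=> up; apply: continuous_cvg => //; exact: linear_euclidean_continuous.
have gle w : (g w < +oo)%E -> (g xs <= (fine (g w) + inner (K (w - xs)) ys)%:E)%E.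
  (* The real bound is [primal_variational] at [k n], solved for [g (x (k n).+1)]. *)
  move=> wfin; apply: (@lsc_le_lim _ _ g (fun n => x (k n).+1) xs (fun n =>
    fine (g w) + inner (dx (k n).+1) (w - x (k n).+1) / tau
    + inner (K (w - x (k n).+1)) (y (k n).+1))) => // [|n].
    apply: cvgD; last first.
      by apply: cvg_inner => //; apply: Kcvg; apply: cvgB => //; exact: cvg_cst.
    rewrite -[X in _ --> X]addr0; apply: cvgD; first exact: cvg_cst.
    rewrite -(mul0r tau^-1) -(inner0l (w - xs)); apply: cvgM; last exact: cvg_cst.
    by apply: cvg_inner => //; apply: cvgB => //; exact: cvg_cst.
  rewrite (proper_fineK g_proper (primal_fin _)) lee_fin.
  have := primal_variational (k n) w wfin.
  by rewrite /dx /= -[x (k n) - _]opprB innerNl; lra.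
have fle v : (fs v < +oo)%E -> (fs ys <= (fine (fs v) + inner (K xs) (ys - v))%:E)%E.
  move=> vfin; apply: (@lsc_le_lim _ _ fs (fun n => y (k n).+1) ys (fun n =>
    fine (fs v) + inner (dy (k n)) (v - y (k n).+1) / sigma
    + inner (K (x (k n) + dx (k n))) (y (k n).+1 - v))) => // [|n].
    apply: cvgD; last first.
      apply: cvg_inner; last by apply: cvgB => //; exact: cvg_cst.
      by apply: Kcvg; rewrite -[xs]addr0; exact: cvgD.
    rewrite -[X in _ --> X]addr0; apply: cvgD; first exact: cvg_cst.
    rewrite -(mul0r sigma^-1) -(inner0l (v - ys)); apply: cvgM; last exact: cvg_cst.
    by apply: cvg_inner => //; apply: cvgB => //; exact: cvg_cst.
  rewrite (proper_fineK fs_proper (dual_fin _)) lee_fin.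
  have := dual_variational (k n) v vfin.
  (* The extrapolated point is the iterate plus a vanishing increment. *)
  have -> : x (k n) + dx (k n) = 2 *: x (k n) - x (k n).-1.
    by rewrite /dx addrA scaler_nat mulr2n.
  rewrite /dy -[y (k n) - _]opprB innerNl.
  by rewrite -(opprB v) innerNr; lra.
apply/saddle_pointP.
have [w1 w1fin] := g_proper.2; have [v1 v1fin] := fs_proper.2.
(* Comparison with one point of each domain places the limit in the domains. *)
have wfin := le_lt_trans (gle _ w1fin) (ltry _).
have vfin := le_lt_trans (fle _ v1fin) (ltry _).
split=> // [w' w'fin|v' v'fin]; rewrite -lee_fin -proper_fineK//; first exact: gle.
exact: fle.
Qed.

Lemma iterates_cvg w0 v0 : saddle_point K f g w0 v0 ->
  exists xs ys, [/\ saddle_point K f g xs ys,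
    x n @[n --> \oo] --> xs & y n @[n --> \oo] --> ys].
Proof.
move=> sp; set C : R := (1 - rho)^-1 * dist2 w0 v0 0%N.
have hC n : dist2 w0 v0 n <= C by exact: iterates_bounded.
have q0 (G : euclideanType R) (p : G) (t : R) : 0 < t -> 0 <= `|p| ^+ 2 / (2 * t).
  by move=> t0; rewrite divr_ge0 ?sqr_ge0// mulr_ge0// ltW.
have xC n : `|x n - w0| ^+ 2 / (2 * tau) <= C.
  by apply: le_trans (hC n); rewrite lerDr q0.
have yC n : `|y n - v0| ^+ 2 / (2 * sigma) <= C.
  by apply: le_trans (hC n); rewrite lerDl q0.
(* Two nested extractions: first for [x], then for [y] along [k1]. *)
have [k1 [xs [hk1 xk1]]] := bounded_seq_cvg_subseq (seq_norm_le _ _ _ _ _ tau_gt0 xC).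
have yk1b := seq_norm_le _ (y \o k1) _ _ _ sigma_gt0 (fun n => yC (k1 n)).
have [k2 [ys [hk2 yk2]]] := bounded_seq_cvg_subseq yk1b.
pose k n := k1 (k2 n).
have hk n : (n <= k n)%N by exact: leq_trans (hk2 n) (hk1 _).
have xk : x (k n) @[n --> \oo] --> xs := cvg_subseq _ _ _ hk2 xk1.
have yk : y (k n) @[n --> \oo] --> ys := yk2.
have sps := limit_saddle_point _ _ _ _ _ sp hk xk yk.
have /saddle_pointP [wfin vfin _ _] := sps.
have [dx0 _] := steps_cvg0 _ _ sp; have dxk := cvg_subseq _ _ _ hk dx0.
(* The energy is now centered at the cluster point instead of the given saddle point. *)
have V0 n : 0 <= V xs ys n.
  by apply: le_trans (V_ge xs ys n); rewrite mulr_ge0// subr_ge0 ltW.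
have Vcvg : cvgn (V xs ys).
  apply: nonincreasing_is_cvgn; last by exists 0 => _ [n _ <-].
  apply/nonincreasing_seqP => n; apply: le_trans (descent xs ys n wfin vfin).
  have := gap_ge0 xs ys n sps.
  have := mulr_ge0 (_ : 0 <= 1 - s) (b_ge0 n); rewrite subr_ge0 ltW// => /(_ isT).
  have : s * a n.+1 <= a n.+1 by rewrite ler_piMl// ltW.
  by rewrite /V; lra.
have quad0 (G : euclideanType R) (u : nat -> G) (t : R) :
    u n @[n --> \oo] --> (0 : G) ->
    `|u n| ^+ 2 / (2 * t) @[n --> \oo] --> (0 : R).
  move=> u0.
  have : `|u n| * `|u n| / (2 * t) @[n --> \oo] -->
      `|0 : G| * `|0 : G| / (2 * t).
    by apply: cvgM; [apply: cvgM; exact: cvg_norm | exact: cvg_cst].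
  by rewrite normr0 !mul0r.
have sub0 (G : euclideanType R) (u : nat -> G) p : u n @[n --> \oo] --> p ->
    u n - p @[n --> \oo] --> (0 : G).
  by move=> up; rewrite -(subrr p); apply: cvgB => //; exact: cvg_cst.
have Vk : V xs ys (k n) @[n --> \oo] --> (0 : R).
  rewrite -[X in _ --> X]addr0; apply: cvgD; last first.
    by rewrite -[X in _ --> X](mulr0 s); apply: cvgM; [exact: cvg_cst | exact: quad0].
  rewrite -[X in _ --> X]addr0; apply: cvgD.
    by rewrite -[X in _ --> X]addr0; apply: cvgD; apply: quad0; exact: sub0.
  have : inner (K (dx (k n))) (y (k n) - ys) @[n --> \oo] --> inner (K 0) (0 : F).
    apply: cvg_inner; last exact: sub0.
    by apply: continuous_cvg => //; exact: linear_euclidean_continuous.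
  by rewrite linear0 inner0l.
have Vlim : limn (V xs ys) = 0.
  exact: (cvg_unique _ (cvg_subseq _ _ _ hk Vcvg) Vk).
have dist2_cvg0 : dist2 xs ys n @[n --> \oo] --> (0 : R).
  have h : (1 - s)^-1 * V xs ys n @[n --> \oo] --> (0 : R).
    rewrite -[X in _ --> X](mulr0 (1 - s)^-1); apply: cvgM; first exact: cvg_cst.
    by rewrite -Vlim.
  apply: (@squeeze_cvgr _ _ _ _ (fun=> 0) _ _ _ _ _ h); last exact: cvg_cst.
  by near=> n; rewrite dist2_ge0 /= mulrC ler_pdivlMr ?subr_gt0// mulrC.
have back (G : euclideanType R) (u : nat -> G) p (t : R) : 0 < t ->
    (forall n, `|u n - p| ^+ 2 / (2 * t) <= dist2 xs ys n) ->
    u n @[n --> \oo] --> p.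
  move=> t0 hu; have up : u n - p @[n --> \oo] --> (0 : G).
    apply: sqr_norm_cvg0.
    have h : 2 * t * dist2 xs ys n @[n --> \oo] --> (0 : R).
      by rewrite -[X in _ --> X](mulr0 (2 * t)); apply: cvgM => //; exact: cvg_cst.
    apply: (@squeeze_cvgr _ _ _ _ (fun=> 0) _ _ _ _ _ h); last exact: cvg_cst.
    by near=> n; rewrite sqr_ge0 /= mulrC -ler_pdivrMr ?mulr_gt0.
  have -> : u = (fun n => u n - p + p) by apply/funext => n; rewrite subrK.
  by rewrite -[X in _ --> X]add0r; apply: cvgD => //; exact: cvg_cst.
exists xs, ys; split=> //.
  by apply: (back _ _ _ tau) => // n; rewrite lerDr q0.
by apply: (back _ _ _ sigma) => // n; rewrite lerDl q0.
Unshelve. all: by end_near. Qed.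

End primal_dual.

Theorem theorem17 (R : realType) (E F : euclideanType R)
    (f : F -> \bar R) (g : E -> \bar R)
    (f_convex : econvex f) (f_proper : proper_function f)
    (f_lsc : lower_semicontinuous f)
    (g_convex : econvex g) (g_proper : proper_function g)
    (g_lsc : lower_semicontinuous g)
    (K : {linear E -> F}) (Kadj : {linear F -> E})
    (K_adjoint : is_adjoint K Kadj)
    (xh : E) (yh : F) (h_saddle : saddle_point K f g xh yh)
    (L : R) (L_def : L = opnorm K)
    (sigma tau : R) (sigma_gt0 : 0 < sigma) (tau_gt0 : 0 < tau)
    (step_lt1 : tau * sigma * L ^+ 2 < 1)
    (x xbar : nat -> E) (y : nat -> F)
    (xbar0 : xbar 0%N = x 0%N)
    (y_step : forall n,
       y n.+1 = prox sigma (conjugate f) (y n + sigma *: K (xbar n)))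
    (x_step : forall n,
       x n.+1 = prox tau g (x n - tau *: Kadj (y n.+1)))
    (xbar_step : forall n, xbar n.+1 = 2 *: x n.+1 - x n) :
  [/\ forall n : nat,
        `|y n - yh| ^+ 2 / (2 * sigma) + `|x n - xh| ^+ 2 / (2 * tau)
        <= (1 - tau * sigma * L ^+ 2)^-1
           * (`|y 0%N - yh| ^+ 2 / (2 * sigma)
              + `|x 0%N - xh| ^+ 2 / (2 * tau)),
      forall N : nat, (1 <= N)%N ->
        forall (B1 : set E) (B2 : set F),
          B1 !=set0 -> B2 !=set0 -> bounded_set B1 -> bounded_set B2 ->
          (partial_gap K f g B1 B2 (average x N) (average y N)
           <= gap_constant tau sigma (x 0%N) (y 0%N) B1 B2
              * (N%:R^-1)%:E)%E
    & exists (xs : E) (ys : F),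
        saddle_point K f g xs ys /\
        (x n, y n) @[n --> \oo] --> (xs, ys)].
Proof.
(* Eliminates [xbar]: at index 0, [2 *: x 0 - x 0.-1] reduces to [x 0], the prescribed [xbar 0]. *)
have y_step' n : y n.+1 =
    prox sigma (conjugate f) (y n + sigma *: K (2 *: x n - x n.-1)).
  rewrite y_step; case: n => [|n]; last by rewrite xbar_step.
  by rewrite xbar0 /= scaler_nat mulr2n addrK.
subst L; split.
- by move=> n; apply: (@iterates_bounded _ _ _ f g) => //; eassumption.
- move=> [//|N] _ B1 B2 _ _ _ _.
  by apply: (@partial_gap_bound _ _ _ f g) => //; eassumption.
- have [xs [ys [sps xxs yys]]] : exists xs ys, [/\ saddle_point K f g xs ys,
      x n @[n --> \oo] --> xs & y n @[n --> \oo] --> ys].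
    exact: (@iterates_cvg R E F f g f_convex f_proper f_lsc g_convex
      g_proper g_lsc K Kadj K_adjoint sigma tau sigma_gt0 tau_gt0 step_lt1 x y
      y_step' x_step _ _ h_saddle).
  by exists xs, ys; split=> //; exact: cvg_pair.
Qed.
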